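(* Let $(\mathcal{H},\mathcal{M})$ be a matroid-rooted mixed hypergraph with $\mathcal{H}=(V\cup R,\mathcal{A}\cup\mathcal{E})$ and $\mathcal{M}=(R,r_{\mathcal{M}})$. Then there exists a matroid-based packing of mixed hyperarborescences in $(\mathcal{H},\mathcal{M})$ if and only if for every biset subpartition $\{\mathsf{X}^i\}_{i=1}^{\ell}$ of $V$ with $X_W^i=N_{\mathcal{H}}^-(X_I^i)\cap R$ for $i=1,\dots,\ell$, $$e_{\mathcal{E}}(\{X_I^i\}_{1}^{\ell})+\sum_{i=1}^{\ell} d^-_{\mathcal{A}}(\mathsf{X}^i)\geq \sum_{i=1}^{\ell}\bigl(r_{\mathcal{M}}(R)-r_{\mathcal{M}}(X_W^i)\bigr).$$
   Context: A mixed hypergraph $\mathcal{H}=(W,\mathcal{A}\cup\mathcal{E})$ has a finite vertex set $W$, a finite (multi)set $\mathcal{A}$ of dyperedges and a finite (multi)set $\mathcal{E}$ of hyperedges. A dyperedge $a$ is a pair $(tail(a),head(a))$ with $head(a)\in W$ and $\emptyset\neq tail(a)\subseteq W-head(a)$; a hyperedge is a subset of $W$ of size at least $2$. For $X\subseteq W$: a dyperedge $a$ enters $X$ if $head(a)\in X$ and $tail(a)-X\neq\emptyset$, and leaves $X$ if it enters $W-X$; a hyperedge enters $X$ if it meets both $X$ and $W-X$; $N^-_{\mathcal{H}}(X)$ is the union of $tail(a)-X$ over all dyperedges $a$ entering $X$. A vertex $r$ is a root if no dyperedge and no hyperedge enters $\{r\}$ and every dyperedge leaving $\{r\}$ has tail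 exactly $\{r\}$. A matroid-rooted mixed hypergraph is a pair $(\mathcal{H},\mathcal{M})$ where $\mathcal{H}=(V\cup R,\mathcal{A}\cup\mathcal{E})$ with $V\cap R=\emptyset$, every vertex of $R$ is a root, and $\mathcal{M}$ is a matroid on $R$ with rank function $r_{\mathcal{M}}$. Trimming a dyperedge $a$ means replacing it by an arc $uv$ with $v=head(a)$, $u\in tail(a)$; trimming a hyperedge $e$ means replacing it by an arc $uv$ with $u\neq v\in e$. An $r$-arborescence is a digraph whose underlying graph is a tree, in which $r$ has in-degree $0$ and every other vertex has in-degree $1$ (possibly just $r$). A mixed $r$-hyperarborescence is a sub-mixed-hypergraph whose dyperedges and hyperedges can be trimmed to give an $r$-arborescence. A matroid-based packing of mixed hyperarborescences is a family $\{\mathcal{B}_r\}_{r\in R}$ of mixed hyperarborescences in $\mathcal{H}$, pairwise sharing no dyperedge and no hyperedge, such that each $\mathcal{B}_r$ can be trimmed to an $r$-arborescence $B_r$ so that for every $v\in V$ the set $\{r\in R:v\in V(B_r)\}$ is a basis of $\mathcal{M}$ (independent of size $r_{\mathcal{M}}(R)$). A biset is $\mathsf{X}=(X_O,X_I)$ with $X_I\subseteq X_O\subseteq V\cup R$; its wall is $X_W=X_O-X_I$. A dyperedge $a$ enters $\mathsf{X}$ if $head(a)\in X_I$ and $tail(a)-X_O\neq\emptyset$; $d^-_{\mathcal{A}}(\mathsf{X})$ is the number of such dyperedges. For $C\subseteq V\cup R$, a biset subpartition of $C$ is a family $\{\mathsf{X}^i\}_{i=1}^{\ell}$ of bisets with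 the $X_I^i$ nonempty, pairwise disjoint subsets of $C$ and $X_W^i\subseteq (V\cup R)-C$ for all $i$. $e_{\mathcal{E}}(\{X_I^i\}_1^\ell)$ is the number of hyperedges entering at least one $X_I^i$. *)

(* Defs.v *)
From mathcomp Require Import all_boot.

Set Implicit Arguments.
Unset Strict Implicit.
Unset Printing Implicit Defensive.

(* The multisets of dyperedges and hyperedges are families indexed by finite
   types, so that parallel copies are distinct indices. *)
Record mixed_hypergraph (W : finType) := MixedHypergraph {
  dyp : finType;
  hyp : finType;
  dtail : dyp -> {set W};
  dhead : dyp -> W;
  hset : hyp -> {set W};
  dtail_neq0 : forall a, dtail a != set0;
  dhead_notin_tail : forall a, dhead a \notin dtail a;
  hset_card : forall e, 1 < #|hset e| }.

Section MixedHypergraph.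
Variables (W : finType) (H : mixed_hypergraph W).
Implicit Types (a : dyp H) (e : hyp H) (X : {set W}).

Definition dyp_enters a X := (dhead a \in X) && (dtail a :\: X != set0).

Definition dyp_leaves a X := dyp_enters a (~: X).

Definition hyp_enters e X :=
  (hset e :&: X != set0) && (hset e :&: ~: X != set0).

Definition in_nbh X : {set W} :=
  \bigcup_(a : dyp H | dyp_enters a X) (dtail a :\: X).

Definition is_root (r : W) : Prop :=
  [/\ forall a, ~~ dyp_enters a [set r],
      forall e, ~~ hyp_enters e [set r] &
      forall a, dyp_leaves a [set r] -> dtail a = [set r]].

Record sub_mixed_hypergraph := SubMixedHypergraph {
  sub_verts : {set W};
  sub_dyps : {set dyp H};
  sub_hyps : {set hyp H};
  sub_dypsP : forall a, a \in sub_dyps ->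
    (dhead a \in sub_verts) && (dtail a \subset sub_verts);
  sub_hypsP : forall e, e \in sub_hyps -> hset e \subset sub_verts }.

End MixedHypergraph.

(* A matroid (R, r) on a subset R of W, given by its rank function; the values
   of the rank outside the subsets of R are irrelevant. *)
Record matroid (W : finType) (R : {set W}) := Matroid {
  mrank : {set W} -> nat;
  mrank_card : forall X : {set W}, X \subset R -> mrank X <= #|X|;
  mrank_mono : forall X Y : {set W}, X \subset Y -> Y \subset R -> mrank X <= mrank Y;
  mrank_submod : forall X Y : {set W}, X \subset R -> Y \subset R ->
    mrank (X :&: Y) + mrank (X :|: Y) <= mrank X + mrank Y }.

Definition indep (W : finType) (R : {set W}) (M : matroid R) (X : {set W}) :=
  (X \subset R) && (mrank M X == #|X|).

Definition basis (W : finType) (R : {set W}) (M : matroid R) (X : {set W}) :=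
  indep M X && (#|X| == mrank M R).

Definition matroid_rooted (W : finType) (V R : {set W})
    (H : mixed_hypergraph W) (M : matroid R) : Prop :=
  [/\ V :|: R = [set: W], [disjoint V & R] &
      forall r, r \in R -> is_root H r].

(* A finite digraph, possibly with parallel arcs: its vertices lie in W and its
   arcs are labelled in I. Values of src and tgt outside arcs are irrelevant. *)
Record digraph (W I : finType) := Digraph {
  verts : {set W};
  arcs : {set I};
  src : I -> W;
  tgt : I -> W;
  arcsP : forall i, i \in arcs -> (src i \in verts) && (tgt i \in verts) }.

Section Digraph.
Variables (W I : finType) (D : digraph W I).

Definition joins (i : I) (x y : W) :=
  (i \in arcs D) &&
  (((src D i == x) && (tgt D i == y)) || ((src D i == y) && (tgt D i == x))).

Definition adjacent : rel W := fun x y => [exists i, joins i x y].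

Definition connected_underlying : Prop :=
  verts D != set0 /\
  forall x y, x \in verts D -> y \in verts D -> connect adjacent x y.

(* c = [:: (x1, i1); ...; (xk, ik)] is a cycle of the underlying multigraph,
   with edge ij between xj and x(j+1), indices modulo k. Loops (k = 1) and
   pairs of parallel or opposite arcs (k = 2) are cycles. *)
Definition underlying_cycle (c : seq (W * I)) :=
  [&& c != [::], uniq (map fst c), uniq (map snd c) &
      cycle (fun p q => joins p.2 p.1 q.1) c].

Definition underlying_tree : Prop :=
  connected_underlying /\ forall c, ~~ underlying_cycle c.

Definition indegree (v : W) := #|[set i in arcs D | tgt D i == v]|.

Definition arborescence (r : W) : Prop :=
  [/\ underlying_tree, r \in verts D, indegree r = 0 &
      forall v, v \in verts D -> v != r -> indegree v = 1].

End Digraph.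

Section Packing.
Variables (W : finType) (H : mixed_hypergraph W).

(* D has exactly one arc for each dyperedge and each hyperedge of B, labelled
   by it. The vertices of B outside D are isolated after the trimming: a vertex
   of a tail or of a hyperedge need not be covered by the arborescence. *)
Definition trimming (B : sub_mixed_hypergraph H)
    (D : digraph W (dyp H + hyp H)%type) : Prop :=
  [/\ verts D \subset sub_verts B,
      arcs D = [set x | match x with
                        | inl a => a \in sub_dyps B
                        | inr e => e \in sub_hyps B
                        end],
      forall a, a \in sub_dyps B ->
        src D (inl a) \in dtail a /\ tgt D (inl a) = dhead a &
      forall e, e \in sub_hyps B ->
        [/\ src D (inr e) \in hset e, tgt D (inr e) \in hset e &
            src D (inr e) != tgt D (inr e)]].

Definition mixed_hyperarborescence (r : W) (B : sub_mixed_hypergraph H) : Prop :=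
  exists D, trimming B D /\ arborescence D r.

(* Only the members of the family B indexed by R matter. *)
Definition matroid_based_packing (V R : {set W}) (M : matroid R)
    (B : W -> sub_mixed_hypergraph H) : Prop :=
  [/\ forall r, r \in R -> mixed_hyperarborescence r (B r),
      forall r s, r \in R -> s \in R -> r != s ->
        [disjoint sub_dyps (B r) & sub_dyps (B s)] /\
        [disjoint sub_hyps (B r) & sub_hyps (B s)] &
      exists D : W -> digraph W (dyp H + hyp H)%type,
        (forall r, r \in R -> trimming (B r) (D r) /\ arborescence (D r) r) /\
        (forall v, v \in V -> basis M [set r in R | v \in verts (D r)])].

End Packing.

Record biset (W : finType) := Biset {
  outer : {set W};
  inner : {set W};
  inner_sub_outer : inner \subset outer }.

Definition wall (W : finType) (X : biset W) := outer X :\: inner X.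

Definition biset_subpartition (W : finType) (C : {set W}) (l : nat)
    (X : 'I_l -> biset W) : Prop :=
  [/\ forall i, inner (X i) != set0,
      forall i, inner (X i) \subset C,
      forall i j, i != j -> [disjoint inner (X i) & inner (X j)] &
      forall i, wall (X i) \subset ~: C].

Definition biset_indegree (W : finType) (H : mixed_hypergraph W) (X : biset W) :=
  #|[set a : dyp H | (dhead a \in inner X) && (dtail a :\: outer X != set0)]|.

Definition hyp_entering (W : finType) (H : mixed_hypergraph W) (l : nat)
    (X : 'I_l -> {set W}) :=
  #|[set e : hyp H | [exists i, hyp_enters e (X i)]]|.

(* Main.v *)
Require Import Defs.
From Stdlib Require Import Classical.
From mathcomp Require Import all_boot all_order all_algebra zify.

(* Since the arcs leaving a root have no other tail, the condition reads
   e(X_1, .., X_l) + sum d(X_i) >= sum (r(R) - r(N(X_i))), where d counts the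
   dyperedges with tail in V that enter X_i and N(X_i) is the set of the roots
   with an arc into X_i.
   Necessity: a root that reaches X_i without belonging to N(X_i) sends an arc
   of its arborescence into X_i from V, and these arcs are distinct.
   Sufficiency: first choose a head for every hyperedge so that
   d(X) >= r(R) - r(N(X)) holds for all X; this works one hyperedge at a time,
   because the sets on which the maximum demand of a partition equals the number
   of hyperedges met are closed under intersection and union. Then grow the
   arborescences by single arcs (no prior trimming is needed), keeping the
   roots S(v) that reach v independent: use the arcs leaving roots as long as
   possible, then take a minimal tight set X in which some S(v) does not span
   the union of the S(w), w in X, and use an arc inside X. *)

Set Implicit Arguments.
Unset Strict Implicit.
Unset Printing Implicit Defensive.

Import GRing.Theory Order.TTheory.

(** * Assigning heads to hyperedges *)

Lemma card_set_sum (I : finType) (p : pred I) :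
  #|[set i | p i]| = \sum_i nat_of_bool (p i).
Proof. by rewrite -sum1dep_card big_mkcond. Qed.

Section Subpartitions.
Variables (T : finType) (V : {set T}).
Implicit Types (X Y U : {set T}) (P Q : seq {set T}) (q : {set T} -> int).

Definition union P := \bigcup_(X <- P) X.

(** Blocks are kept in a list so that uncrossing can insert them one at a time by induction. *)
Fixpoint subpartition P :=
  if P is X :: P' then
    [&& X != set0, X \subset V, [disjoint X & union P'] & subpartition P']
  else true.

Definition weight q P : int := (\sum_(X <- P) q X)%R.

Definition intersecting_supermodular q :=
  forall X Y, X \subset V -> Y \subset V -> X :&: Y != set0 ->
    (q X + q Y <= q (X :&: Y) + q (X :|: Y))%R.

Lemma union_cons X P : union (X :: P) = X :|: union P.
Proof. by rewrite /union big_cons. Qed.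

Lemma union_cat P Q : union (P ++ Q) = union P :|: union Q.
Proof. by rewrite /union big_cat. Qed.

Lemma weight_cons q X P : weight q (X :: P) = (q X + weight q P)%R.
Proof. by rewrite /weight big_cons. Qed.

Lemma weight_cat q P Q : weight q (P ++ Q) = (weight q P + weight q Q)%R.
Proof. by rewrite /weight big_cat. Qed.

Lemma subpartition_cat P Q :
  subpartition P -> subpartition Q -> [disjoint union P & union Q] ->
  subpartition (P ++ Q).
Proof.
elim: P => //= X P IH /and4P[-> -> dXP sP] sQ.
rewrite union_cons union_cat -!setI_eq0 setIUl setIUr !setU_eq0.
by rewrite !setI_eq0 dXP => /andP[-> dPQ]; rewrite IH.
Qed.

(** * Uncrossing of subpartitions *)

Section Uncrossing.
Variable q : {set T} -> int.
Hypothesis q_super : intersecting_supermodular q.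

(** [Z] grows from [X] by absorbing each block [Y] of [P] that meets [X], while [X :&: Y] goes to
    [P2]; the other blocks go to [P1]. As [Y] is disjoint from the other blocks,
    [Z :&: Y = X :&: Y], and supermodularity applies to [Z] and [Y]. *)
Lemma uncross_block X P : X != set0 -> X \subset V -> subpartition P ->
  exists (Z : {set T}) (P1 P2 : seq {set T}),
    [/\ [/\ X \subset Z, subpartition (Z :: P1) &
            union (Z :: P1) = X :|: union P],
        subpartition P2, union P2 = X :&: union P &
        (q X + weight q P <= q Z + weight q P1 + weight q P2)%R].
Proof.
move=> X0 XV; elim: P => [|Y P IH] /=.
  move=> _; exists X, [::], [::]; split => //.
  - split=> //; last by rewrite union_cons.
    by rewrite /= X0 XV /union big_nil -setI_eq0 setI0 eqxx.
  - by rewrite /union big_nil setI0.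
  - by rewrite /weight !big_nil !addr0.
move=> /and4P[Y0 YV dYP sP].
have [Z [P1 [P2 [[XZ /= /and4P[Z0 ZV dZ sP1] uZ] sP2 uP2 le_w]]]] := IH sP.
rewrite union_cons in uZ.
have P1P : union P1 \subset union P.
  apply/subsetP=> x xP1; have : x \in Z :|: union P1 by rewrite inE xP1 orbT.
  rewrite uZ inE => /orP[xX|//]; have xZ := subsetP XZ x xX.
  by rewrite (disjointFr dZ xZ) in xP1.
have dYP1 : [disjoint Y & union P1] by apply: disjointWr dYP.
have ZY : Z :&: Y = X :&: Y.
  apply/eqP; rewrite eqEsubset (setSI _ XZ) andbT; apply/subsetP=> x.
  rewrite !inE => /andP[xZ xY]; rewrite xY andbT.
  have : x \in Z :|: union P1 by rewrite inE xZ.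
  by rewrite uZ inE (disjointFr dYP xY) orbF.
have [XY0|XY0] := eqVneq (X :&: Y) set0.
  exists Z, (Y :: P1), P2; split => //=.
  - split=> //; last by rewrite !union_cons setUCA uZ setUCA.
    rewrite Z0 ZV Y0 YV dYP1 sP1 !andbT union_cons.
    by rewrite -setI_eq0 setIUr ZY XY0 set0U setI_eq0 dZ.
  - by rewrite union_cons setIUr XY0 set0U.
  - by rewrite !weight_cons; move: le_w; clear; lia.
exists (Z :|: Y), P1, ((X :&: Y) :: P2); split => //=.
- split; first exact: subset_trans XZ (subsetUl _ _).
    rewrite setU_eq0 (negPf Z0) subUset ZV YV sP1 andbT /=.
    by rewrite -setI_eq0 setIUl setU_eq0 !setI_eq0 dZ dYP1.
  by rewrite !union_cons setUAC uZ -setUA (setUC (union P)).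
- rewrite XY0 subIset ?XV // uP2 sP2 andbT /= -setI_eq0 setIACA setIid.
  by rewrite (eqP (_ : Y :&: union P == set0)) ?setI0 // setI_eq0.
- by rewrite !union_cons uP2 setIUr.
- rewrite !weight_cons.
  have := q_super ZV YV; rewrite ZY => /(_ XY0); move: le_w; clear; lia.
Qed.

(** The blocks of [P] are inserted one by one into the partition of the growing union. A new block
    is disjoint from the earlier ones, so the pieces it cuts off cover exactly its intersection with
    [union Q]. *)
Lemma uncross P Q : subpartition P -> subpartition Q ->
  exists P' Q' : seq {set T},
    [/\ subpartition P', subpartition Q', union P' = union P :&: union Q,
        union Q' = union P :|: union Q &
        (weight q P + weight q Q <= weight q P' + weight q Q')%R].
Proof.
move=> sP sQ; elim: P sP => [|X P IH] /=.
  move=> _; exists [::], Q; split => //.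
  - by rewrite /union big_nil set0I.
  - by rewrite {2}/union big_nil set0U.
case/and4P=> X0 XV dXP sP.
have [P' [Q' [sP' sQ' uP' uQ' le_w]]] := IH sP.
have [Z [P1 [P2 [[XZ sZ uZ] sP2 uP2 le_w2]]]] := uncross_block X0 XV sQ'.
have uP2' : union P2 = X :&: union Q.
  by rewrite uP2 uQ' setIUr (eqP (_ : X :&: union P == set0)) ?set0U // setI_eq0.
exists (P2 ++ P'), (Z :: P1); split => //.
- apply: subpartition_cat => //; rewrite uP2' uP' -setI_eq0 setIACA setIid.
  by rewrite (eqP (_ : X :&: union P == set0)) ?set0I // setI_eq0.
- by rewrite union_cat uP2' uP' union_cons setIUl.
- by rewrite uZ uQ' union_cons setUA.
- by rewrite weight_cat !weight_cons; move: le_w le_w2; clear; lia.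
Qed.

End Uncrossing.

(** By disjointness, [v] lies in at most one block. *)
Lemma weight_sub_mem q v P : subpartition P ->
  weight (fun X => q X - (v \in X)%:Z)%R P
    = (weight q P - (v \in union P)%:Z)%R.
Proof.
elim: P => [|X P IH] /=.
  by rewrite /weight /union !big_nil inE.
case/and4P=> _ _ dXP /IH e; rewrite !weight_cons e union_cons inE; clear -dXP.
case vX: (v \in X) => /=; last by lia.
by rewrite (disjointFr dXP vX); lia.
Qed.

(** * Choice of heads meeting an intersecting supermodular demand *)

Section Assignment.
Variables (I : finType) (s : I -> {set T}).
Hypothesis s_neq0 : forall e, s e != set0.

Definition meeting (E : {set I}) U := #|[set e in E | s e :&: U != set0]|.

Lemma meetingD1 (E : {set I}) e U : e \in E ->
  meeting E U = (s e :&: U != set0) + meeting (E :\ e) U.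
Proof.
move=> eE; rewrite /meeting (cardsD1 e) !inE eE; congr (_ + #|pred_of_set _|).
by apply/setP=> x; rewrite !inE andbA.
Qed.

Lemma meeting_submod E U X :
  meeting E (U :&: X) + meeting E (U :|: X) <= meeting E U + meeting E X.
Proof.
rewrite /meeting !card_set_sum -!big_split /=.
apply: leq_sum => e _ /=; rewrite !setIUr setU_eq0.
case: (e \in E) => //=.
have : (s e :&: (U :&: X) != set0) -> (s e :&: U != set0) && (s e :&: X != set0).
  case/set0Pn=> x; rewrite !inE => /and3P[xe xU xX].
  by apply/andP; split; apply/set0Pn; exists x; rewrite inE xe.
by case: (s e :&: (U :&: X) != set0); case: (s e :&: U == set0);
  case: (s e :&: X == set0) => // /(_ isT).
Qed.

(* Giving the head [v] to a hyperedge [e] lowers the demand of the sets that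
   contain [v]; this fails only if some tight [U] meets [s e] but avoids [v]. If
   this happens for all [v] in [s e], then a tight [U] with [s e :&: U] minimal
   and a tight [U'] avoiding a vertex of [s e :&: U] cannot be uncrossed. *)
Lemma assignment (E : {set I}) q : intersecting_supermodular q ->
  (forall P, subpartition P -> (weight q P <= (meeting E (union P))%:Z)%R) ->
  exists h : I -> T, (forall e, h e \in s e) /\
    forall X, X != set0 -> X \subset V ->
      (q X <= #|[set e in E | h e \in X]|%:Z)%R.
Proof.
have [n] := ubnP #|E|; elim: n E q => // n IH E q cE q_super q_le.
have [E0|[e eE]] := set_0Vmem E.
  pose h e := xchoose (set0Pn _ (s_neq0 e)).
  exists h; split=> [e|X X0 XV]; first exact: (xchooseP (set0Pn _ (s_neq0 e))).
  have := q_le [:: X]; rewrite /= X0 XV weight_cons /weight big_nil addr0.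
  rewrite {1}/union big_nil -setI_eq0 setI0 eqxx => /(_ isT).
  rewrite /meeting; set m := #|_|; have -> : m = 0.
    by apply: eq_card0 => x; rewrite E0 !inE.
  by clear; lia.
pose qv v X := (q X - (v \in X)%:Z)%R.
have [[v [vs qv_le]]|no_v] := classic (exists v, v \in s e /\
    forall P, subpartition P ->
      (weight (qv v) P <= (meeting (E :\ e) (union P))%:Z)%R).
  have [||h [hs h_le]] := IH (E :\ e) (qv v) _ _ qv_le.
  - by rewrite (cardsD1 e) eE in cE.
  - move=> X Y XV YV XY0; have := q_super X Y XV YV XY0.
    by rewrite /qv !inE; clear; case: (v \in X); case: (v \in Y) => /=; lia.
  exists (fun f => if f == e then v else h f); split=> [f|X X0 XV].
    by case: eqP => [->|].
  have := h_le X X0 XV; rewrite /qv (cardsD1 e [set f in E | _]) !inE eE eqxx /=.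
  set m := #|_|; set m' := #|_|; suff -> : m = m' by lia.
  apply: eq_card => x; rewrite !inE andbA.
  by case: (x == e); case: (x \in E).
pose tight U := exists P, [/\ subpartition P, union P = U &
  weight q P = (meeting E U)%:Z%R].
have blocked v : v \in s e -> exists U, [/\ tight U, v \notin U & s e :&: U != set0].
  move=> vs; apply: NNPP => no_U; apply: no_v; exists v; split=> // P sP.
  (* If [P] violates the lowered bound, then the bound for [q] leaves only one possibility: [P] is
     tight, avoids [v], and its union meets [s e]. *)
  rewrite weight_sub_mem // leNgt; apply/negP=> lt_P; apply: no_U.
  exists (union P); have := q_le P sP; move: lt_P; rewrite (meetingD1 _ eE).
  have [vP|vP] := boolP (v \in union P).
    have -> : s e :&: union P != set0 by apply/set0Pn; exists v; rewrite inE vs.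
    by clear; lia.
  case: (s e :&: union P != set0) (meetingD1 (union P) eE) => /= eq_m lt_P le_P;
    last by move: lt_P le_P; clear; lia.
  by split=> //; exists P; split=> //; rewrite eq_m; move: lt_P le_P; clear; lia.
suff no_tight U : tight U -> s e :&: U == set0.
  have /set0Pn[v /blocked[U [/no_tight ->]]] := s_neq0 e.
  by [].
have [m] := ubnP #|s e :&: U|; elim: m U => // m IHm U lt_m tU.
apply: contraT => /set0Pn[v]; rewrite inE => /andP[vs vU].
have [U' [tU' vU' eU']] := blocked v vs.
case: (tU) (tU') => [P [sP uP wP]] [Q [sQ uQ wQ]].
have [P' [Q' [sP' sQ' uP' uQ' le_w]]] := uncross q_super sP sQ.
rewrite uP uQ in uP' uQ'.
have leP := q_le _ sP'; have leQ := q_le _ sQ'; rewrite uP' uQ' in leP leQ.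
have submod := meeting_submod E U U'.
have tI : tight (U :&: U') by exists P'; split=> //;
  move: le_w leP leQ submod wP wQ; clear; lia.
have eI : s e :&: (U :&: U') == set0.
  rewrite ltnS in lt_m; apply: IHm tI; apply: leq_trans lt_m.
  apply: proper_card; apply/properP; split; first by rewrite setIS ?subsetIl.
  by exists v; rewrite !inE ?vs ?vU // (negPf vU').
(* [e] is counted for [U], [U'] and [U :|: U'] but not for [U :&: U'], so submodularity of
   [meeting E] is strict here, against the tightness of [U] and [U']. *)
have submod' := meeting_submod (E :\ e) U U'.
have mU := meetingD1 U eE; have mU' := meetingD1 U' eE.
have mI := meetingD1 (U :&: U') eE; have mX := meetingD1 (U :|: U') eE.
have eU : s e :&: U != set0 by apply/set0Pn; exists v; rewrite inE vs.
rewrite eI /= in mI; rewrite eU' in mU'; rewrite eU in mU.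
rewrite setIUr setU_eq0 (negPf eU) /= in mX.
move: le_w leP leQ wP wQ submod' mU mU' mI mX; clear; lia.
Qed.

End Assignment.
End Subpartitions.

(** * Arborescences *)

Section AddLeaf.
Variables (W I : finType) (D : digraph W I) (a : I) (u v : W).
Hypothesis uD : u \in verts D.

Definition add_leaf_src i := if i == a then u else src D i.
Definition add_leaf_tgt i := if i == a then v else tgt D i.

Fact add_leaf_arcsP i : i \in a |: arcs D ->
  (add_leaf_src i \in v |: verts D) && (add_leaf_tgt i \in v |: verts D).
Proof.
rewrite /add_leaf_src /add_leaf_tgt !inE.
by case: eqP => /= [_|_ /arcsP/andP[-> ->]]; rewrite ?uD ?eqxx ?orbT.
Qed.

Definition add_leaf : digraph W I := Digraph add_leaf_arcsP.

Hypotheses (aD : a \notin arcs D) (vD : v \notin verts D).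

Lemma joins_add_leaf i x y : i != a -> joins add_leaf i x y = joins D i x y.
Proof.
move=> ia; rewrite /joins !inE (negPf ia) /=.
by rewrite /add_leaf_src /add_leaf_tgt (negPf ia).
Qed.

Lemma joins_verts i x y : joins D i x y -> (x \in verts D) && (y \in verts D).
Proof.
by case/andP=> /arcsP/andP[sD tD] /orP[] /andP[/eqP<- /eqP<-]; rewrite sD tD.
Qed.

Lemma joins_leaf i x : joins add_leaf i v x -> (i == a) && (x == u).
Proof.
have [-> |ia] := eqVneq i a; last first.
  by rewrite joins_add_leaf // => /joins_verts; rewrite (negPf vD).
rewrite /joins /= /add_leaf_src /add_leaf_tgt eqxx => /andP[_ /orP[]].
  by case/andP=> /eqP uv; move: vD; rewrite -uv uD.
by case/andP; rewrite eq_sym => ->.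
Qed.

Lemma joinsC (D' : digraph W I) i x y : joins D' i x y = joins D' i y x.
Proof. by rewrite /joins orbC. Qed.

(* The arc [a] is the only one at [v], while a vertex of a cycle lies on two
   of its arcs. *)
Lemma add_leaf_acyclic c :
  (forall c', ~~ underlying_cycle D c') -> ~~ underlying_cycle add_leaf c.
Proof.
move=> acyc; apply/negP => /and4P[c0 u1 u2 cyc].
have [vc|vc] := boolP (v \in map fst c); last first.
  move: (acyc c); rewrite /underlying_cycle c0 u1 u2 /=.
  suff -> : cycle (fun p q => joins D p.2 p.1 q.1) c by [].
  apply: (sub_in_cycle (P := [pred p | p.1 != v])) cyc; last first.
    apply/allP=> p pc /=; apply: contraNneq vc => <-.
    exact: map_f.
  move=> p q /= pv qv jpq; rewrite -joins_add_leaf //.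
  apply: contraTneq jpq => ->; rewrite /joins /= /add_leaf_tgt eqxx.
  by rewrite (eq_sym v q.1) (eq_sym v) (negPf pv) (negPf qv) !andbF.
(* Once the cycle is rotated to start at [v], its first and last arcs are both at [v], hence both
   equal to [a], while the labels of a cycle are distinct. *)
case/mapP: vc => -[x i] /= /rot_to[n c' rot_c] vx.
rewrite -{x}vx in rot_c.
rewrite -(rot_cycle n) rot_c in cyc.
rewrite -(rot_uniq n) -map_rot rot_c /= in u2.
case/lastP: c' rot_c cyc u2 => [|c' [y j]] _ /=.
  by case/andP=> /joins_leaf /andP[_ /eqP vu]; move: vD; rewrite vu uD.
rewrite map_rcons mem_rcons inE negb_or /= => cyc /andP[/andP[ij _] _].
case: c' cyc => [|[z k] c'] /=.
  case/and3P=> /joins_leaf/andP[/eqP ia _]; rewrite joinsC => /joins_leaf.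
  by rewrite -ia eq_sym (negPf ij).
case/andP=> /joins_leaf/andP[/eqP ia _]; rewrite !rcons_path last_rcons /=.
by case/andP=> _; rewrite joinsC => /joins_leaf; rewrite -ia eq_sym (negPf ij).
Qed.

Lemma add_leaf_connect x y : connect (adjacent D) x y ->
  connect (adjacent add_leaf) x y.
Proof.
apply: connect_sub => {}x {}y /existsP[i jxy]; apply/connect1/existsP.
exists i; rewrite joins_add_leaf //; apply: contraNneq aD => <-.
by case/andP: jxy.
Qed.

Lemma add_leaf_connected : connected_underlying D ->
  connected_underlying add_leaf.
Proof.
case=> D0 conD; split=> [|x y].
  by apply/set0Pn; exists v; rewrite !inE eqxx.
have uv : adjacent add_leaf u v.
  apply/existsP; exists a.
  by rewrite /joins !inE /= /add_leaf_src /add_leaf_tgt !eqxx.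
have vu : adjacent add_leaf v u.
  by case/existsP: uv => i; rewrite joinsC => jvu; apply/existsP; exists i.
rewrite !inE => /orP[/eqP->|xD] /orP[/eqP->|yD].
- exact: connect0.
- exact: connect_trans (connect1 vu) (add_leaf_connect (conD _ _ uD yD)).
- exact: connect_trans (add_leaf_connect (conD _ _ xD uD)) (connect1 uv).
- exact: add_leaf_connect (conD _ _ xD yD).
Qed.

Lemma indegree_add_leaf x : indegree add_leaf x = (x == v) + indegree D x.
Proof.
rewrite /indegree (cardsD1 a) !inE eqxx /= /add_leaf_tgt eqxx eq_sym.
congr (_ + _); apply: eq_card => i; rewrite !inE.
by have [->|] := eqVneq i a; rewrite //= (negPf aD).
Qed.

Lemma indegree_notin (D' : digraph W I) x : x \notin verts D' -> indegree D' x = 0.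
Proof.
move=> xD; apply/eqP; rewrite cards_eq0; apply/eqP/setP=> i; rewrite !inE.
by apply/negP=> /andP[/arcsP/andP[_ tD] /eqP tx]; rewrite tx (negPf xD) in tD.
Qed.

Lemma add_leaf_arborescence r : arborescence D r -> arborescence add_leaf r.
Proof.
case=> -[con acyc] rD r0 in1; split.
- by split; [exact: add_leaf_connected | move=> c; exact: add_leaf_acyclic].
- by rewrite !inE rD orbT.
- rewrite indegree_add_leaf r0 addn0; have [rv|//] := eqVneq r v.
  by rewrite rv (negPf vD) in rD.
- move=> x; rewrite !inE indegree_add_leaf.
  have [-> _ _|_ /= xD xr] := eqVneq x v; last by rewrite in1.
  by rewrite indegree_notin.
Qed.

End AddLeaf.

Section Singleton.
Variables (W I : finType) (r : W).

Fact singleton_arcsP (i : I) :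
  i \in set0 -> (r \in [set r]) && (r \in [set r]).
Proof. by rewrite in_set0. Qed.

Definition singleton_digraph : digraph W I :=
  @Digraph W I [set r] set0 (fun=> r) (fun=> r) singleton_arcsP.

Lemma singleton_arborescence : arborescence singleton_digraph r.
Proof.
split.
- split; last first.
    case=> [//|[x i] c]; apply/negP=> /and4P[_ _ _] /=.
    by case: c => [|p c] /=; rewrite /joins inE.
  split; first by apply/set0Pn; exists r; exact: set11.
  by move=> x y /set1P-> /set1P->; exact: connect0.
- exact: set11.
- by apply/eqP; rewrite cards_eq0; apply/eqP/setP=> i; rewrite !inE.
- by move=> x /set1P-> /eqP.
Qed.

End Singleton.

(** * Arcs of an arborescence entering a set *)

Lemma periodic_point (T : finType) (f : T -> T) x :
  exists2 y, fconnect f x y & fcycle f (orbit f y).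
Proof.
(* By finiteness the iterates return to an earlier one, [iter j f x], which is therefore
   periodic. *)
have /trajectP[j lt_j eq_j] : iter (order f x) f x \in traject f x (order f x).
  exact: looping_order.
exists (iter j f x); first exact: fconnect_iter.
rewrite -fconnect_f.
rewrite -iterS -[order f x](subnK lt_j) in eq_j *.
rewrite -[X in fconnect _ _ X]eq_j iterD.
exact: fconnect_iter.
Qed.

(* Otherwise the unique arcs entering the vertices of [X] would lead back inside
   [X] forever, hence around a cycle. *)
Lemma arborescence_enters (W I : finType) (D : digraph W I) r (X : {set W}) v :
  arborescence D r -> r \notin X -> v \in X -> v \in verts D ->
  exists i, [/\ i \in arcs D, tgt D i \in X & src D i \notin X].
Proof.
case=> -[_ acyc] rD r0 in1 rX vX vD.
have [/existsP[i /and3P[]]|] := boolP [exists i, [&& i \in arcs D,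
  tgt D i \in X & src D i \notin X]]; first by exists i.
rewrite negb_exists => /forallP no_i.
have in_arc x : x \in X :&: verts D -> exists i, (i \in arcs D) && (tgt D i == x).
  rewrite inE => /andP[xX xD]; have xr : x != r by apply: contraNneq rX => <-.
  have : 0 < indegree D x by rewrite in1.
  by case/card_gt0P=> i; rewrite inE => ?; exists i.
have /in_arc[i0 _] : v \in X :&: verts D by rewrite inE vX.
(* On [X :&: verts D], [g x] is an arc entering [x], and the default [i0] is never taken. *)
pose g x := odflt i0 [pick i in arcs D | tgt D i == x].
have gP x : x \in X :&: verts D -> (g x \in arcs D) && (tgt D (g x) == x).
  rewrite /g; case: pickP => [//|no_g] /in_arc[i].
  by rewrite no_g.
pose f x := src D (g x).
have fP x : x \in X :&: verts D -> f x \in X :&: verts D.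
  move=> xXD; have /andP[gD /eqP gx] := gP x xXD.
  have := no_i (g x); rewrite gD gx /= (subsetP (subsetIl _ _) _ xXD) /= negbK.
  by rewrite inE => ->; case/arcsP/andP: gD.
have itP n x : x \in X :&: verts D -> iter n f x \in X :&: verts D.
  by move=> xXD; elim: n => //= n; exact: fP.
have [y /iter_findex y_it cyc] := periodic_point f v.
have yXD : y \in X :&: verts D by rewrite -y_it itP // inE vX.
have orbXD x : x \in orbit f y -> x \in X :&: verts D.
  by case/trajectP=> n _ ->; exact: itP.
(* The orbit of [f] follows the arcs backwards, which [joins] permits; its labels are distinct
   because [g x] determines its target [x]. *)
case/negP: (acyc [seq (x, g x) | x <- orbit f y]); apply/and4P; split.
- by rewrite /orbit /= -orderSpred.
- by rewrite -map_comp map_id orbit_uniq.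
- rewrite -map_comp map_inj_in_uniq ?orbit_uniq // => x z /orbXD xX /orbXD zX /= gxz.
  have /andP[_ /eqP <-] := gP x xX; rewrite gxz.
  by have /andP[_ /eqP] := gP z zX.
- rewrite cycle_map /=; apply: (sub_in_cycle (P := mem (X :&: verts D))) cyc.
    move=> x z xX zX /= /eqP <-; rewrite /joins.
    by have /andP[-> ->] := gP x xX; rewrite /f eqxx orbT.
  by apply/allP=> x /orbXD.
Qed.

(** * Growing the arborescences *)

Section MatroidRank.
Variables (W : finType) (R : {set W}) (M : matroid R).
Implicit Types (X Y Z : {set W}) (x y : W).
Notation rk := (mrank M).

(** Membership of [x] in the closure of [X]: within [R], the reverse inequality is monotonicity. *)
Definition spans X x := rk (x |: X) <= rk X.

Lemma mem_spans X x : x \in X -> spans X x.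
Proof. by move=> xX; rewrite /spans (setUidPr _) ?sub1set. Qed.

Lemma spans_mono X Y x : X \subset Y -> Y \subset R -> x \in R ->
  spans X x -> spans Y x.
Proof.
move=> XY YR xR; rewrite /spans => sp_x.
have xYR : x |: Y \subset R by rewrite subUset sub1set xR.
have xXR : x |: X \subset R by apply: subset_trans xYR; exact: setUS.
have := mrank_submod M xXR YR.
rewrite -setUA (setUidPr XY) => sub.
have : rk X <= rk ((x |: X) :&: Y).
  apply: mrank_mono; first by rewrite subsetI subsetUr XY.
  by rewrite subIset // YR orbT.
by move: sub sp_x; clear; lia.
Qed.

Lemma mrank_spanned X Y : X \subset R -> Y \subset R ->
  (forall y, y \in Y -> spans X y) -> rk (X :|: Y) <= rk X.
Proof.
move=> XR; have [n] := ubnP #|Y|; elim: n Y => // n IH Y cY YR spY.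
have [->|[y yY]] := set_0Vmem Y; first by rewrite setU0.
have {IH} le_XY : rk (X :|: Y :\ y) <= rk X.
  apply: IH.
  - by rewrite (cardsD1 y) yY in cY.
  - exact: subset_trans (subsetDl _ _) YR.
  - by move=> z /setD1P[_]; exact: spY.
have XYR : X :|: Y :\ y \subset R.
  by rewrite subUset XR (subset_trans (subsetDl _ _) YR).
have yR := subsetP YR y yY.
have : spans (X :|: Y :\ y) y by apply: spans_mono (spY y yY); rewrite ?subsetUl.
rewrite /spans setUCA (setD1K yY); move: le_XY; clear; lia.
Qed.

Lemma indepU1 X x : x \in R -> indep M X -> ~~ spans X x -> indep M (x |: X).
Proof.
move=> xR /andP[XR /eqP rX]; rewrite /spans -ltnNge => lt_x.
have xXR : x |: X \subset R by rewrite subUset sub1set xR.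
rewrite /indep xXR eqn_leq mrank_card //=.
have := cardsU1 x X; case: (x \in X) => /=; move: lt_x; rewrite rX; clear; lia.
Qed.

(** Submodularity for [X] and [x |: Y], whose intersection contains [x |: Z]: adding [x] to [Y]
    costs no rank, so [rk (x |: Z)] is at most [rk X + rk Y - rk (X :|: Y)]. *)
Lemma spans_meet X Y Z x : X \subset R -> Y \subset R -> x \in X ->
  Z \subset X :&: Y -> spans Y x -> rk X + rk Y <= rk Z + rk (X :|: Y) ->
  spans Z x.
Proof.
move=> XR YR xX ZXY spYx le_rk; rewrite /spans.
have xYR : x |: Y \subset R by rewrite subUset sub1set (subsetP XR).
have := mrank_submod M XR xYR.
have : rk (x |: Z) <= rk (X :&: (x |: Y)).
  apply: mrank_mono; last by rewrite subIset // XR.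
  rewrite subUset sub1set !inE xX eqxx /=.
  by apply: subset_trans ZXY _; apply: setIS; exact: subsetUr.
have : rk (X :|: Y) <= rk (X :|: (x |: Y)).
  apply: mrank_mono; last by rewrite subUset XR.
  by rewrite setUS ?subsetUr.
move: spYx le_rk; rewrite /spans; clear; lia.
Qed.

End MatroidRank.

(** * Packings grown arc by arc *)

Section Growth.
Variables (W I : finType) (V R : {set W}) (M : matroid R).
Variables (tl : I -> {set W}) (hd : I -> W).
Hypotheses (VR : [disjoint V & R]) (hd_V : forall i, hd i \in V).
Hypothesis tl_VR : forall i, tl i \subset V \/ exists2 r, r \in R & tl i = [set r].
Implicit Types (A : {set I}) (X Y : {set W}) (S : W -> {set W}).

Notation rk := (mrank M).

(* [S v] is the set of the roots whose arborescence already contains [v], and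
   [A] is the set of the arcs that are still available. *)
Definition packed S A := exists D : W -> digraph W I,
  [/\ forall r, r \in R -> arborescence (D r) r /\ verts (D r) = [set v | r \in S v],
      forall r, r \in R -> [disjoint arcs (D r) & A],
      forall r i, r \in R -> i \in arcs (D r) ->
        src (D r) i \in tl i /\ tgt (D r) i = hd i &
      forall r s, r \in R -> s \in R -> r != s ->
        [disjoint arcs (D r) & arcs (D s)]].

Definition extend S v r := fun w => if w == v then r |: S v else S w.

(** Trimming takes place here: the tail vertex [u] is fixed when [a] is used, and [a] leaves [A] so
    that the arc sets stay disjoint. *)
Lemma packed_extend S A a u r : packed S A -> a \in A -> u \in tl a ->
  r \in R -> r \in S u -> r \notin S (hd a) ->
  packed (extend S (hd a) r) (A :\ a).
Proof.
case=> D [arbD disA endsD disD] aA ua rR ru ra.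
have [arbr vertr] := arbD r rR.
have uD : u \in verts (D r) by rewrite vertr inE.
have vD : hd a \notin verts (D r) by rewrite vertr inE.
have notD s : s \in R -> a \notin arcs (D s).
  by move=> sR; apply/negP=> /(disjointFr (disA s sR)); rewrite aA.
exists (fun s => if s == r then add_leaf a (hd a) uD else D s); split.
- move=> s sR; have [->|sr] := eqVneq s r.
  + split; first exact: add_leaf_arborescence (notD r rR) vD _ arbr.
    rewrite /= vertr; apply/setP=> w; rewrite !inE /extend.
    by case: eqP => [->|]; rewrite ?inE ?eqxx.
  + have [arbs ->] := arbD s sR; split=> //.
    apply/setP=> w; rewrite !inE /extend.
    by case: eqP => [->|]; rewrite ?inE ?(negPf sr).
- move=> s sR; have dA : [disjoint arcs (D s) & A :\ a].
    exact: disjointWr (subsetDl _ _) (disA s sR).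
  case: eqP dA => [->|_ //] /=.
  rewrite -!setI_eq0 setIUl setU_eq0 => ->.
  by rewrite andbT setI_eq0 disjoints1 !inE eqxx.
- move=> s i sR; case: eqP => [_|_]; last exact: endsD.
  rewrite !inE /= /add_leaf_src /add_leaf_tgt.
  by have [->|ia] := eqVneq i a; last exact: endsD.
- have disr s : s \in R -> r != s -> [disjoint a |: arcs (D r) & arcs (D s)].
    move=> sR rs; rewrite -!setI_eq0 setIUl setU_eq0 !setI_eq0 disD //.
    by rewrite disjoints1 notD.
  move=> s t sR tR; have [-> rt|sr] := eqVneq s r; last have [->|tr] := eqVneq t r.
  + by rewrite eq_sym (negPf rt) disr.
  + by rewrite disjoint_sym => _; apply: disr; rewrite // eq_sym.
  + exact: disD.
Qed.

Definition reach S X := \bigcup_(v in X) S v.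

Definition root_nbh A X := \bigcup_(a in A | hd a \in X) (tl a :&: R).

(** Arcs leaving roots are left out; they are accounted for by [root_nbh]. *)
Definition entering A X :=
  #|[set a in A | [&& hd a \in X, tl a \subset V & ~~ (tl a \subset X)]]|.

Lemma enteringD1 A X a : a \in A ->
  entering A X =
    [&& hd a \in X, tl a \subset V & ~~ (tl a \subset X)] + entering (A :\ a) X.
Proof.
move=> aA; rewrite /entering (cardsD1 a) !inE aA /=; congr (_ + _).
by apply: eq_card => i; rewrite !inE andbA.
Qed.

Lemma entering_submod A X Y :
  entering A (X :&: Y) + entering A (X :|: Y) <= entering A X + entering A Y.
Proof.
rewrite /entering !card_set_sum -!big_split /=; apply: leq_sum => a _.
rewrite !inE subsetI; case: (a \in A); case: (tl a \subset V); rewrite ?andbF //=.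
have : (tl a \subset X) ==> (tl a \subset X :|: Y).
  by apply/implyP=> taX; apply: subset_trans taX (subsetUl _ _).
have : (tl a \subset Y) ==> (tl a \subset X :|: Y).
  by apply/implyP=> taX; apply: subset_trans taX (subsetUr _ _).
by case: (tl a \subset X); case: (tl a \subset Y);
  case: (tl a \subset _ :|: _); case: (hd a \in X); case: (hd a \in Y).
Qed.

Lemma reach_subR S X : (forall v, v \in V -> S v \subset R) -> X \subset V ->
  reach S X \subset R.
Proof. by move=> SR XV; apply/bigcupsP=> v /(subsetP XV); exact: SR. Qed.

Lemma reach_sup S X v : v \in X -> S v \subset reach S X.
Proof. by move=> vX; exact: bigcup_sup. Qed.

Lemma reach_mono S X Y : X \subset Y -> reach S X \subset reach S Y.
Proof. by move=> XY; apply/bigcupsP=> v /(subsetP XY); exact: reach_sup. Qed.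

Lemma reach_setU S X Y : reach S (X :|: Y) = reach S X :|: reach S Y.
Proof. by rewrite /reach bigcup_setU. Qed.

Lemma root_nbh_subR A X : root_nbh A X \subset R.
Proof. by apply/bigcupsP=> a _; exact: subsetIr. Qed.

Lemma sub_extend S v r w : S w \subset extend S v r w.
Proof. by rewrite /extend; case: eqP => [->|//]; exact: subsetUr. Qed.

Lemma reach_extend S v r X : reach S X \subset reach (extend S v r) X.
Proof.
apply/bigcupsP=> w wX; apply: subset_trans (sub_extend S v r w) _.
exact: reach_sup.
Qed.

Lemma reach_extend_in S v r X : v \in X ->
  r |: reach S X \subset reach (extend S v r) X.
Proof.
move=> vX; rewrite subUset reach_extend andbT sub1set.
by apply/bigcupP; exists v; rewrite // /extend eqxx !inE eqxx.
Qed.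

(** The cut condition at the stage where arcs leaving roots bring no new rank. *)
Definition covered S A := forall X, X != set0 -> X \subset V ->
  rk R <= rk (reach S X) + entering A X.

(* The arc is found inside a minimal tight set [X] such that some [S v] with
   [v] in [X] does not span [reach S X]; a tight set [Z] that forbids using it
   would make [X :&: Z] a smaller set of the same kind. *)
Lemma good_arc S A : (forall v, v \in V -> S v \subset R) -> covered S A ->
  (exists2 v, v \in V & rk (S v) < rk R) ->
  exists a u r, [/\ a \in A, u \in tl a, r \in S u, r \in R & u \in V /\
    ~~ spans M (S (hd a)) r /\ covered (extend S (hd a) r) (A :\ a)].
Proof.
move=> SR cov [v0 v0V lt_v0].
have rR X := @reach_subR S X SR.
pose P X := [&& X != set0, X \subset V, rk (reach S X) + entering A X <= rk R &
  [exists v in X, rk (S v) < rk (reach S X)]].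
(* [V] is tight because no arc with its tail in [V] enters it. *)
have PV : P V.
  have V0 : V != set0 by apply/set0Pn; exists v0.
  have dV : entering A V = 0.
    apply/eqP; rewrite cards_eq0; apply/eqP/setP=> a; rewrite !inE.
    by case: (tl a \subset V); rewrite ?andbF.
  rewrite /P V0 subxx dV addn0 mrank_mono ?rR //=.
  apply/exists_inP; exists v0 => //; have := cov V V0 (subxx _).
  by rewrite dV addn0; exact: leq_trans.
have [X /minsetP[/and4P[X0 XV tX /exists_inP[v vX lt_v]] minX] _] := minset_exists PV.
have vV := subsetP XV v vX.
pose Y := [set w in X | [forall r in S w, spans M (S v) r]].
have vY : v \in Y.
  by rewrite inE vX /=; apply/forall_inP=> r; exact: mem_spans.
have YX : Y \subset X by apply/subsetP=> w; rewrite inE => /andP[].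
have YV := subset_trans YX XV.
have le_Y : rk (reach S Y) <= rk (S v).
  apply: leq_trans (mrank_spanned (SR v vV) (rR Y YV) _).
    by apply: mrank_mono; rewrite ?subsetUr // subUset SR // rR.
  move=> r /bigcupP[w]; rewrite inE => /andP[_ /forall_inP sp_w]; exact: sp_w.
(* [reach S Y] has smaller rank than [reach S X]; as [X] is tight, more arcs enter [Y] than [X], so
   some arc entering [Y] has its tail inside [X]. *)
have lt_d : entering A X < entering A Y.
  have Y0 : Y != set0 by apply/set0Pn; exists v.
  by have := cov Y Y0 YV; move: tX lt_v le_Y; clear; lia.
have [a aY aX] : exists2 a, a \in [set a in A | [&& hd a \in Y, tl a \subset V &
    ~~ (tl a \subset Y)]] & a \notin [set a in A | [&& hd a \in X, tl a \subset V &
    ~~ (tl a \subset X)]].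
  apply/subsetPn; apply: contraTN lt_d => /subset_leq_card.
  by rewrite -leqNgt.
move: aY aX; rewrite !inE => /and4P[aA /andP[wX /forall_inP sp_w] tV tY].
rewrite aA tV wX /= negbK => tX'.
have /subsetPn[u ua uY] := tY.
have uX := subsetP tX' u ua; have uV := subsetP XV u uX.
move: uY; rewrite inE uX /= => /forall_inPn[r ru nsp_v].
have rRR := subsetP (SR u uV) r ru.
have wV := subsetP XV _ wX.
set w := hd a in wX wV sp_w *.
(* [S v] spans [S w], so it would span [r] as well if [S w] did. *)
have nsp_w : ~~ spans M (S w) r.
  apply: contra nsp_v => /(spans_mono (subsetUr (S v) (S w))) sp_r.
  have vwR : S v :|: S w \subset R by rewrite subUset !SR.
  have := sp_r vwR rRR; have := mrank_spanned (SR v vV) (SR w wV) sp_w.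
  have : rk (r |: S v) <= rk (r |: (S v :|: S w)).
    by apply: mrank_mono; rewrite ?setUS ?subsetUl // subUset sub1set rRR.
  by rewrite /spans; clear; lia.
exists a, u, r; split=> //; split=> //; split=> // Z Z0 ZV.
have covZ := cov Z Z0 ZV; rewrite (enteringD1 Z aA) tV /= in covZ.
have ext_R : reach (extend S w r) Z \subset R.
  apply: reach_subR ZV => y yV; rewrite /extend; case: eqP => _; last exact: SR.
  by rewrite subUset sub1set rRR SR.
have := mrank_mono M (reach_extend S w r Z) ext_R.
(* The inequality of [Z] can fail only if [a] enters [Z], [reach S Z] already spans [r], and [Z] is
   tight; the other cases are dismissed in turn. *)
have [/andP[wZ tZ]|] := boolP ((w \in Z) && ~~ (tl a \subset Z)); last first.
  by move: covZ; rewrite -/w; case: (_ && _) => //= + _; clear; lia.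
have := mrank_mono M (reach_extend_in S r wZ) ext_R.
have [sp_r|] := boolP (spans M (reach S Z) r); last first.
  by rewrite /spans; move: covZ; rewrite -/w wZ tZ; clear; lia.
have [|tight_Z] := ltnP (rk R) (rk (reach S Z) + entering A Z).
  by rewrite (enteringD1 Z aA) tV -/w wZ tZ; clear; lia.
have wXZ : w \in X :&: Z by rewrite inE wX.
have XZ0 : X :&: Z != set0 by apply/set0Pn; exists w.
have XZV : X :&: Z \subset V by rewrite subIset ?XV.
have XUZ0 : X :|: Z != set0 by rewrite setU_eq0 (negPf X0).
have XUZV : X :|: Z \subset V by rewrite subUset XV.
have covI := cov _ XZ0 XZV; have covU := cov _ XUZ0 XUZV.
have subd := entering_submod A X Z.
have reachI : reach S (X :&: Z) \subset reach S X :&: reach S Z.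
  by rewrite subsetI !reach_mono ?subsetIl ?subsetIr.
have subr := mrank_submod M (rR X XV) (rR Z ZV).
have leI : rk (reach S (X :&: Z)) <= rk (reach S X :&: reach S Z).
  by apply: mrank_mono; rewrite // subIset ?rR.
rewrite -reach_setU in subr.
(* [r] lies in [reach S X] through [u]. Tightness of [X] and [Z], with the cut conditions of their
   intersection and union, gives the rank inequality that [spans_meet] requires. *)
have sp_I : spans M (reach S (X :&: Z)) r.
  apply: (@spans_meet _ _ _ (reach S X) (reach S Z)) sp_r _; rewrite ?rR //.
    exact: subsetP (reach_sup S uX) r ru.
  rewrite -reach_setU; move: tX tight_Z covI covU subd; clear; lia.
(* Minimality would give [X \subset Z], but the tail of [a] lies in [X] and not in [Z]. *)
suff : P (X :&: Z).
  move=> /minX /(_ (subsetIl _ _)) XZ; case/negP: tZ.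
  by apply: subset_trans tX' _; rewrite -XZ subsetIr.
rewrite /P XZ0 XZV /=; apply/andP; split.
  by move: tX tight_Z covU subd subr leI; clear; lia.
apply/exists_inP; exists w => //; rewrite ltnNge.
apply: contra nsp_w => le_w; rewrite /spans.
have : rk (r |: S w) <= rk (r |: reach S (X :&: Z)).
  apply: mrank_mono; first by rewrite setUS ?reach_sup.
  by rewrite subUset sub1set rRR rR.
by move: sp_I le_w; rewrite /spans; clear; lia.
Qed.

(** Induction on the number of available arcs. The invariant treats roots with an available arc into
    [X] as if they already reached [X]. *)
Lemma grow S A : packed S A -> (forall v, v \in V -> indep M (S v)) ->
  (forall r, r \in R -> r \in S r) ->
  (forall X, X != set0 -> X \subset V ->
     rk R <= rk (reach S X :|: root_nbh A X) + entering A X) ->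
  exists S' A', packed S' A' /\ forall v, v \in V -> basis M (S' v).
Proof.
have [n] := ubnP #|A|; elim: n S A => // n IH S A cA pack indS rootS cov.
have SR v : v \in V -> S v \subset R by move=> /indS/andP[].
have notR v : v \in V -> v \notin R by move=> vV; rewrite (disjointFr VR vV).
(* Using an arc for a root not spanned at its head preserves the rest of the invariant, so only the
   cut condition remains to be checked. *)
have step a u r : a \in A -> u \in tl a -> r \in R -> r \in S u ->
    ~~ spans M (S (hd a)) r ->
    (forall X, X != set0 -> X \subset V -> rk R <=
      rk (reach (extend S (hd a) r) X :|: root_nbh (A :\ a) X)
        + entering (A :\ a) X) ->
    exists S' A', packed S' A' /\ forall v, v \in V -> basis M (S' v).
  move=> aA ua rR ru nsp; apply: IH.
  - by rewrite (cardsD1 a) aA in cA.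
  - by apply: packed_extend ru _ => //; apply: contra nsp; exact: mem_spans.
  - move=> v vV; rewrite /extend; case: eqP => [_|_]; last exact: indS.
    by apply: indepU1; rewrite ?indS.
  - by move=> s sR; apply: subsetP (rootS s sR); exact: sub_extend.
have extR v r X : r \in R -> X \subset V -> reach (extend S v r) X \subset R.
  move=> rR; apply: reach_subR => w wV; rewrite /extend; case: eqP => [<-|_].
    by rewrite subUset sub1set rR SR.
  exact: SR.
have [/exists_inP[a aA /exists_inP[r rR /andP[/eqP ta nsp]]]|no_root] :=
  boolP [exists a in A, exists r in R, (tl a == [set r]) && ~~ spans M (S (hd a)) r].
  apply: (step a r r) => //; rewrite ?ta ?set11 ?rootS // => X X0 XV.
  have := cov X X0 XV; rewrite (enteringD1 X aA) ta sub1set.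
  have /negPf-> : r \notin V by apply: contraL rR; exact: notR.
  rewrite andbF /= add0n => /leq_trans; apply; rewrite leq_add2r.
  apply: mrank_mono; last by rewrite subUset extR ?root_nbh_subR.
  (* Removing [a] can delete only [r] from [root_nbh], and [r] now reaches [hd a]. *)
  apply/subsetP=> s; rewrite !inE => /orP[/(subsetP (reach_extend _ _ _ _))-> //|].
  case/bigcupP=> b /andP[bA bX] sb; have [ba|ba] := eqVneq b a.
    move: sb bX; rewrite ba ta !inE => /andP[/eqP-> _] aX.
    by rewrite (subsetP (reach_extend_in S r aX)) // !inE eqxx.
  by apply/orP; right; apply/bigcupP; exists b; rewrite // !inE ba bA.
(* Every root in [root_nbh A X] is now spanned at the head of its arc, hence by [reach S X]. *)
have {}cov : covered S A.
  move=> X X0 XV; apply: leq_trans (cov X X0 XV) _; rewrite leq_add2r.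
  apply: mrank_spanned; rewrite ?reach_subR ?root_nbh_subR // => s.
  case/bigcupP=> b /andP[bA bX]; rewrite inE => /andP[sb sR].
  have [/subsetP/(_ s sb)/notR|[r rR tb]] := tl_VR b; first by rewrite sR.
  move: sb; rewrite tb inE => /eqP sr.
  apply: (spans_mono (reach_sup S bX)); rewrite ?reach_subR //.
  apply: contraR no_root => nsp; apply/exists_inP; exists b => //.
  by apply/exists_inP; exists s; rewrite // tb sr eqxx -sr.
have [/exists_inP lt_v|no_v] := boolP [exists v in V, rk (S v) < rk R].
  have [a [u [r [aA ua ru rR [uV [nsp cov']]]]]] := good_arc SR cov lt_v.
  apply: (step a u r) => // X X0 XV; apply: leq_trans (cov' X X0 XV) _.
  rewrite leq_add2r; apply: mrank_mono; first exact: subsetUl.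
  by rewrite subUset extR ?root_nbh_subR.
exists S, A; split=> // v vV; rewrite /basis indS //=.
have /andP[_ /eqP <-] := indS v vV; rewrite eqn_leq mrank_mono ?SR //=.
rewrite leqNgt; apply: contra no_v => lt_v; apply/exists_inP; exists v => //.
Qed.

End Growth.

(** * Matroid-rooted mixed hypergraphs *)

Lemma weight_sub (T : finType) (f g : {set T} -> nat) P :
  weight (fun X => (f X)%:Z - (g X)%:Z)%R P
    = ((\sum_(X <- P) f X)%:Z - (\sum_(X <- P) g X)%:Z)%R.
Proof.
elim: P => [|X P IH]; first by rewrite /weight !big_nil.
by rewrite weight_cons IH !big_cons; clear; lia.
Qed.

Lemma subpartition_mem (T : finType) (V : {set T}) P X :
  subpartition V P -> X \in P -> (X != set0) && (X \subset V).
Proof.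
elim: P => //= Y P IH /and4P[Y0 YV _ sP]; rewrite inE => /orP[/eqP->|].
  by rewrite Y0.
exact: IH.
Qed.

Lemma sub_union (T : finType) (P : seq {set T}) X :
  X \in P -> X \subset union P.
Proof.
elim: P => // Y P IH; rewrite inE union_cons => /orP[/eqP->|/IH XP].
  exact: subsetUl.
exact: subset_trans XP (subsetUr _ _).
Qed.

Lemma subpartition_nth (T : finType) (V : {set T}) P i j : subpartition V P ->
  i < j < size P -> [disjoint nth set0 P i & nth set0 P j].
Proof.
elim: P i j => [|X P IH] i j; first by rewrite ltn0 andbF.
case/and4P=> _ _ dX sP; case: i j => [|i] [|j] //=; rewrite !ltnS => lt_ij.
  by apply: disjointWr dX; apply: sub_union; exact: mem_nth.
exact: IH.
Qed.

Section MatroidRooted.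
Variables (W : finType) (V R : {set W}) (H : mixed_hypergraph W) (M : matroid R).
Hypothesis HM : matroid_rooted V H M.
Implicit Types (X Y : {set W}) (a : dyp H) (e : hyp H).

Notation rk := (mrank M).

Let VR : [disjoint V & R]. Proof. by case: HM. Qed.

Lemma notin_roots v : (v \notin R) = (v \in V).
Proof.
have [VUR _ _] := HM.
have : v \in V :|: R by rewrite VUR inE.
rewrite inE => /orP[vV|vR]; first by rewrite vV (disjointFr VR vV).
by rewrite vR (disjointFl VR vR).
Qed.

Lemma dtail_root a r : r \in R -> r \in dtail a -> dtail a = [set r].
Proof.
have [_ _ rootR] := HM; move=> rR ra; have [_ _ leaves] := rootR r rR.
apply: leaves; rewrite /dyp_leaves /dyp_enters !inE; apply/andP; split.
  by apply: contraNneq (dhead_notin_tail a) => ->.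
by apply/set0Pn; exists r; rewrite !inE eqxx.
Qed.

Lemma dhead_V a : dhead a \in V.
Proof.
have [_ _ rootR] := HM; rewrite -notin_roots; apply/negP=> aR.
have [/(_ a) + _ _] := rootR _ aR; rewrite /dyp_enters inE eqxx /=.
have /set0Pn[x xa] := dtail_neq0 a; case/negP; apply/set0Pn; exists x.
by rewrite !inE xa andbT; apply: contraNneq (dhead_notin_tail a) => <-.
Qed.

Lemma dtail_VR a : dtail a \subset V \/ exists2 r, r \in R & dtail a = [set r].
Proof.
have [|/subsetPn[r ra]] := boolP (dtail a \subset V); first by left.
rewrite -notin_roots negbK => rR; right; exists r => //; exact: dtail_root.
Qed.

Lemma hset_V e : hset e \subset V.
Proof.
have [_ _ rootR] := HM; apply/subsetP=> r re; rewrite -notin_roots; apply/negP=> rR.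
have [_ /(_ e) + _] := rootR r rR; rewrite /hyp_enters negb_and => /orP[]; case/negP.
  by apply/set0Pn; exists r; rewrite !inE re eqxx.
have := hset_card e; rewrite (cardsD1 r) re ltnS => /card_gt0P[x].
by rewrite -setDE => ?; apply/set0Pn; exists x.
Qed.

Lemma hset_neq0 e : hset e != set0.
Proof. by rewrite -card_gt0 ltnW // hset_card. Qed.

(** The wall prescribed for a biset with inner set [X]. *)
Definition in_roots X := in_nbh H X :&: R.

Lemma in_rootsP X r : X \subset V ->
  reflect (r \in R /\ exists2 a : dyp H, dhead a \in X & r \in dtail a)
    (r \in in_roots X).
Proof.
move=> XV; rewrite /in_roots inE andbC; apply: (iffP andP) => -[rR]; last first.
  case=> a aX ra; split=> //.
  have rX : r \notin X by apply: contraTN rR => /(subsetP XV); rewrite notin_roots.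
  apply/bigcupP; exists a; last by rewrite inE rX.
  by rewrite /dyp_enters aX; apply/set0Pn; exists r; rewrite inE rX.
by case/bigcupP=> a /andP[aX _] /setDP[ra _]; split=> //; exists a.
Qed.

Lemma in_rootsU X Y : X \subset V -> Y \subset V ->
  in_roots (X :|: Y) = in_roots X :|: in_roots Y.
Proof.
move=> XV YV; have XYV : X :|: Y \subset V by rewrite subUset XV.
apply/setP=> r; rewrite in_setU; apply/(in_rootsP _ XYV)/orP.
  by case=> rR [a]; rewrite inE => /orP[aX|aY] ra; [left|right];
    apply/in_rootsP=> //; split=> //; exists a.
by case=> /in_rootsP[] // rR [a aX ra]; split=> //; exists a; rewrite // inE aX ?orbT.
Qed.

Lemma in_rootsI X Y : X \subset V -> Y \subset V ->
  in_roots (X :&: Y) \subset in_roots X :&: in_roots Y.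
Proof.
move=> XV YV; have XYV : X :&: Y \subset V by rewrite subIset ?XV.
apply/subsetP=> r /(in_rootsP _ XYV)[rR [a]]; rewrite inE => /andP[aX aY] ra.
by rewrite in_setI; apply/andP; split; apply/in_rootsP=> //; split=> //; exists a.
Qed.

Lemma in_roots_subR X : in_roots X \subset R.
Proof. exact: subsetIr. Qed.

(* An arc leaving a root never counts in the in-degree of a biset whose wall
   contains all the roots with an arc into its inner set. *)
Definition dyp_indegree X := entering V (@dtail W H) (@dhead W H) setT X.

Definition hyp_inside X := #|[set e : hyp H | hset e \subset X]|.

Lemma hyp_inside_supermod X Y :
  hyp_inside X + hyp_inside Y <= hyp_inside (X :&: Y) + hyp_inside (X :|: Y).
Proof.
rewrite /hyp_inside !card_set_sum -!big_split /=; apply: leq_sum => e _.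
rewrite subsetI.
have : (hset e \subset X) ==> (hset e \subset X :|: Y).
  by apply/implyP=> eX; apply: subset_trans eX (subsetUl _ _).
have : (hset e \subset Y) ==> (hset e \subset X :|: Y).
  by apply/implyP=> eX; apply: subset_trans eX (subsetUr _ _).
by case: (hset e \subset X); case: (hset e \subset Y); case: (hset e \subset _ :|: _).
Qed.

(* The demand of [X] on the number of hyperedges with head in [X], those inside
   [X] included. *)
Definition demand X : int :=
  ((rk R - rk (in_roots X) + hyp_inside X)%:Z - (dyp_indegree X)%:Z)%R.

(** [in_roots] turns unions into unions and sends an intersection into the intersection, so its rank
    is submodular on subsets of [V]; so is [dyp_indegree], while [hyp_inside] is supermodular. *)
Lemma demand_supermod : intersecting_supermodular V demand.
Proof.
move=> X Y XV YV _; rewrite /demand.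
have := hyp_inside_supermod X Y.
have := entering_submod V (@dtail W H) (@dhead W H) setT X Y.
have := mrank_submod M (in_roots_subR X) (in_roots_subR Y).
rewrite -in_rootsU //.
have : rk (in_roots (X :&: Y)) <= rk (in_roots X :&: in_roots Y).
  by apply: mrank_mono; rewrite ?in_rootsI // subIset ?in_roots_subR.
(* This bound keeps the natural subtraction in [demand] from truncating. *)
have rR Z : rk (in_roots Z) <= rk R by rewrite mrank_mono ?in_roots_subR.
move: (rR X) (rR Y) (rR (X :&: Y)) (rR (X :|: Y)); rewrite /dyp_indegree.
by clear; lia.
Qed.

Lemma biset_indegreeE (B : biset W) : inner B \subset V ->
  wall B = in_roots (inner B) -> biset_indegree H B = dyp_indegree (inner B).
Proof.
move=> BV wB; apply: eq_card => a; rewrite !inE.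
case aB: (dhead a \in inner B) => //=.
have oB : outer B = inner B :|: in_roots (inner B).
  by rewrite -wB /wall -{1}(setID (outer B) (inner B)) (setIidPr (inner_sub_outer B)).
rewrite setD_eq0 oB; have [aV|[r rR ta]] := dtail_VR a.
  rewrite aV; congr (~~ _); apply/subsetP/subsetP=> sub x xa; last by rewrite inE sub.
  have := sub x xa; rewrite inE => /orP[//|/(subsetP (in_roots_subR _))].
  by apply: contraTT => _; rewrite notin_roots (subsetP aV).
have -> : dtail a \subset V = false.
  by rewrite ta sub1set -notin_roots rR.
apply/negbF; rewrite ta sub1set inE; apply/orP; right.
by apply/in_rootsP=> //; split=> //; exists a; rewrite // ta inE.
Qed.

Definition biset_of X := Biset (subsetUl X (in_roots X)).

Lemma wall_biset_of X : X \subset V -> wall (biset_of X) = in_roots X.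
Proof.
move=> XV; rewrite /wall /= setDUl setDv set0U; apply/setDidPl.
apply: disjointWl (in_roots_subR X) _; apply: disjointWr XV _.
by rewrite disjoint_sym.
Qed.

Definition partition_condition := forall (l : nat) (X : 'I_l -> biset W),
  biset_subpartition V X ->
  (forall i, wall (X i) = in_nbh H (inner (X i)) :&: R) ->
  \sum_(i < l) (rk R - rk (wall (X i))) <=
  hyp_entering H (fun i => inner (X i)) + \sum_(i < l) biset_indegree H (X i).

(** A hyperedge inside one [X i] misses the others and enters none, so each hyperedge counts at most
    once on the left, and only if it meets [U]. *)
Lemma hyp_entering_inside l (X : 'I_l -> {set W}) (U : {set W}) :
  (forall i j, i != j -> [disjoint X i & X j]) -> (forall i, X i \subset U) ->
  hyp_entering H X + \sum_(i < l) hyp_inside (X i) <= meeting (@hset W H) setT U.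
Proof.
move=> disX XU; rewrite /hyp_entering /hyp_inside /meeting card_set_sum.
under [X in _ + X]eq_bigr => i _ do rewrite card_set_sum.
rewrite exchange_big /= -big_split card_set_sum /=; apply: leq_sum => e _.
have /set0Pn[x xe] := hset_neq0 e.
have [/existsP[i eXi]|] := boolP [exists i, hset e \subset X i]; last first.
  rewrite negb_exists => /forallP no_i; rewrite big1 ?addn0 => [|i _]; last first.
    by rewrite (negPf (no_i i)).
  case: existsP => // -[i /andP[/set0Pn[y /setIP[ye yX]] _]]; rewrite inE lt0b.
  by apply/set0Pn; exists y; rewrite inE ye (subsetP (XU i)).
have notX j y : j != i -> y \in hset e -> y \notin X j.
  by move=> /disX dij ye; rewrite (disjointFl dij) // (subsetP eXi).
rewrite (bigD1 i) //= eXi big1 => [|j ji]; last first.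
  by apply/eqP; rewrite eqb0; apply/subsetPn; exists x; rewrite // notX.
have -> : hset e :&: U != set0.
  by apply/set0Pn; exists x; rewrite inE xe (subsetP (XU i)) ?(subsetP eXi).
rewrite inE addn0 (_ : [exists _, _] = false) //; apply/existsP=> -[j /andP[]].
have [->|ji] := eqVneq j i; first by rewrite -setDE setD_eq0 eXi.
by case/set0Pn=> y /setIP[ye yX]; rewrite (negPf (notX j y ji ye)) in yX.
Qed.

(** The condition is applied to the bisets with the blocks of [P] as inner sets; adding the
    hyperedges inside blocks to both sides turns those entering a block into those meeting the
    union. *)
Lemma demand_le P : partition_condition -> subpartition V P ->
  (weight demand P <= (meeting (@hset W H) setT (union P))%:Z)%R.
Proof.
move=> cond sP; pose X (i : 'I_(size P)) := nth set0 P i.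
have mX i : X i \in P by exact: mem_nth.
have XV i : X i \subset V by have /andP[] := subpartition_mem sP (mX i).
have disX i j : i != j -> [disjoint X i & X j].
  rewrite neq_ltn => /orP[lt_ij|lt_ji]; last rewrite disjoint_sym;
    by apply: (subpartition_nth sP); rewrite ?lt_ij ?lt_ji /=.
have wX i : wall (biset_of (X i)) = in_roots (X i) by exact: wall_biset_of.
have bX : biset_subpartition V (biset_of \o X).
  split=> //= i; first by have /andP[] := subpartition_mem sP (mX i).
  rewrite wX; apply: subset_trans (in_roots_subR _) _.
  by rewrite -disjoints_subset disjoint_sym.
have := cond _ _ bX wX.
have sumX (F : {set W} -> nat) : \sum_(Y <- P) F Y = \sum_i F (X i).
  by rewrite (big_nth set0) big_mkord.
under eq_bigr => i _ do rewrite wX.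
under [X in _ <= _ + X]eq_bigr => i _ do rewrite biset_indegreeE //=.
rewrite weight_sub !sumX big_split /=.
have := @hyp_entering_inside _ (fun i => X i) _ disX (fun i => sub_union (mX i)).
by rewrite /=; clear; lia.
Qed.

(** * Hyperedges turned into dyperedges by a choice of heads *)

Section Orientation.
Variable h : hyp H -> W.
Hypothesis h_in : forall e, h e \in hset e.

Definition oriented_tail (x : dyp H + hyp H) :=
  match x with inl a => dtail a | inr e => hset e :\ h e end.
Definition oriented_head (x : dyp H + hyp H) :=
  match x with inl a => dhead a | inr e => h e end.

(** A hyperedge with head in [X] either lies inside [X] or enters [X] once oriented. *)
Lemma oriented_entering X :
  entering V oriented_tail oriented_head setT X + hyp_inside X
    = dyp_indegree X + #|[set e in [set: hyp H] | h e \in X]|.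
Proof.
rewrite /dyp_indegree /entering /hyp_inside !card_set_sum big_sumType /=.
rewrite -addnA -big_split /=; congr (_ + _).
  by apply: eq_bigr => a _; rewrite !inE.
apply: eq_bigr => e _.
rewrite !inE /=.
have -> : hset e :\ h e \subset V by rewrite (subset_trans (subsetDl _ _)) ?hset_V.
have [hX|hX] := boolP (h e \in X); last first.
  by rewrite (_ : hset e \subset X = false) //; apply: contraNF hX => /subsetP->.
rewrite -{2}(setD1K (h_in e)) subUset sub1set hX /=.
by case: (_ \subset X).
Qed.

End Orientation.

(** * Sufficiency of the condition *)

Lemma packing_exists : partition_condition ->
  exists B : W -> sub_mixed_hypergraph H, matroid_based_packing V M B.
Proof.
move=> cond.
have [h [h_in h_le]] := assignment hset_neq0 demand_supermod (fun P => demand_le cond).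
pose tl := oriented_tail h; pose hd := oriented_head h.
(* Growth starts from one-vertex arborescences: a root is reached only by itself, and a vertex of
   [V] by no root. *)
pose S v := if v \in R then [set v] else set0.
have hd_V x : hd x \in V.
  by case: x => [a|e] /=; [exact: dhead_V | exact: subsetP (hset_V e) _ (h_in e)].
have tl_VR x : tl x \subset V \/ exists2 r, r \in R & tl x = [set r].
  case: x => [a|e] /=; first exact: dtail_VR.
  by left; exact: subset_trans (subsetDl _ _) (hset_V e).
have [] := @grow _ _ V R M tl hd VR hd_V tl_VR S setT.
- exists (singleton_digraph _); split=> //.
  + move=> r rR; split; first exact: singleton_arborescence.
    apply/setP=> v; rewrite !inE /S; case: ifP => [_|vR]; first by rewrite inE eq_sym.
    by rewrite inE; apply: contraFF vR => /eqP->.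
  + by move=> r _; rewrite disjoints_subset sub0set.
  + by move=> r i _; rewrite inE.
  + by move=> r s _ _ _; rewrite disjoints_subset sub0set.
- move=> v; rewrite -notin_roots /S => /negPf->.
  rewrite /indep sub0set cards0 -leqn0 -[X in _ <= X](@cards0 W).
  by rewrite mrank_card ?sub0set.
- by move=> r rR; rewrite /S rR inE.
- move=> X X0 XV; have := h_le X X0 XV; have := oriented_entering h_in X.
  have : rk (in_roots X) <= rk (reach S X :|: root_nbh R tl hd setT X).
    apply: mrank_mono.
      apply/subsetP=> r /(in_rootsP _ XV)[rR [a aX ra]]; rewrite inE; apply/orP; right.
      by apply/bigcupP; exists (inl a); rewrite ?inE ?ra.
    rewrite subUset root_nbh_subR andbT; apply: reach_subR XV => v.
    by rewrite -notin_roots /S => /negPf->; exact: sub0set.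
  by rewrite /demand -/tl -/hd; clear; lia.
move=> S' [A' [[D [arbD _ endsD disD]] basisS]].
(* All of [W] can serve as the vertex set of each [B r], since a trimming only needs [verts (D r)]
   to lie in it. *)
have sub_dypP r a : a \in [set a | inl a \in arcs (D r)] ->
    (dhead a \in setT) && (dtail a \subset setT) by rewrite in_setT subsetT.
have sub_hypP r e : e \in [set e | inr e \in arcs (D r)] -> hset e \subset setT.
  by rewrite subsetT.
pose B r := SubMixedHypergraph (@sub_dypP r) (@sub_hypP r).
have trimB r : r \in R -> trimming (B r) (D r) /\ arborescence (D r) r.
  move=> rR; split; last by case: (arbD r rR).
  split; rewrite ?subsetT //.
  - by apply/setP=> -[a|e]; rewrite !inE.
  - by move=> a; rewrite inE => /(endsD r _ rR).
  - move=> e; rewrite inE => /(endsD r _ rR)[/setD1P[sh se] ->]; split=> //.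
    exact: h_in.
exists B; split.
- by move=> r rR; exists (D r); exact: trimB.
- move=> r s rR sR rs; have dis := disD r s rR sR rs.
  split; rewrite -setI_eq0; apply/eqP/setP=> x; rewrite !inE;
    by apply/negP=> /andP[/(disjointFr dis)->].
- exists D; split=> // v vV; suff -> : [set r in R | v \in verts (D r)] = S' v.
    exact: basisS.
  apply/setP=> r; rewrite inE; apply/andP/idP => [[rR]|rv].
    by have [_ ->] := arbD r rR; rewrite inE.
  have rR : r \in R.
    by have /andP[/andP[/subsetP SR _] _] := basisS v vV; exact: SR.
  by split=> //; have [_ ->] := arbD r rR; rewrite inE.
Qed.

(** * Necessity of the condition *)

Lemma packing_condition (B : W -> sub_mixed_hypergraph H) :
  matroid_based_packing V M B -> partition_condition.
Proof.
case=> _ disB [D [trimD basisD]] l X [X0 XV disX wXV] wX.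
pose T i := [set x | [exists r in R, [&& r \notin wall (X i), x \in arcs (D r),
  tgt (D r) x \in inner (X i) & src (D r) x \notin inner (X i)]]].
have arcs_inj r s x : r \in R -> s \in R -> x \in arcs (D r) -> x \in arcs (D s) ->
    r = s.
  move=> rR sR; have [[_ -> _ _] _] := trimD r rR; have [[_ -> _ _] _] := trimD s sR.
  rewrite !inE => xr xs; apply/eqP; apply: contraLR xs => /(disB r s rR sR)[da dh].
  by case: x xr => [a|e] xr; rewrite ?(disjointFr da xr) ?(disjointFr dh xr).
(* Take the basis [b] of roots reaching some [v] in the inner set. At least [rk R - rk (wall (X i))]
   of them avoid the wall, and each sends an arc into the inner set; these arcs have distinct
   labels. *)
have le_T i : rk R - rk (wall (X i)) <= #|T i|.
  have /set0Pn[v vX] := X0 i; have vV := subsetP (XV i) v vX.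
  have /andP[/andP[bR /eqP rkb] /eqP cb] := basisD v vV.
  set b := [set r in R | _] in bR rkb cb.
  have wR : wall (X i) \subset R by rewrite wX subsetIr.
  have bw : #|b :&: wall (X i)| <= rk (wall (X i)).
    have bwR : b :&: wall (X i) \subset R by rewrite subIset ?bR.
    have bDR : b :\: wall (X i) \subset R by rewrite (subset_trans (subsetDl _ _)).
    (* The part of [b] in the wall is independent, by submodularity for the two parts of [b]. *)
    apply: leq_trans (mrank_mono M (subsetIr b (wall (X i))) wR).
    have := mrank_submod M bwR bDR; have := mrank_card M bDR.
    by rewrite setID rkb -(cardsID (wall (X i)) b); clear; lia.
  have enters r : r \in b :\: wall (X i) -> exists x, [&& x \in arcs (D r),
      tgt (D r) x \in inner (X i) & src (D r) x \notin inner (X i)].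
    rewrite !inE => /and3P[_ rR vr]; have [_ arb] := trimD r rR.
    have rX : r \notin inner (X i).
      by apply: contraTN rR => /(subsetP (XV i)); rewrite notin_roots.
    have [x [xD tX sX]] := arborescence_enters arb rX vX vr.
    by exists x; rewrite xD tX.
  pose f r := [pick x | [&& x \in arcs (D r), tgt (D r) x \in inner (X i)
    & src (D r) x \notin inner (X i)]].
  have fP r : r \in b :\: wall (X i) -> exists2 x, f r = Some x &
      [&& x \in arcs (D r), tgt (D r) x \in inner (X i)
        & src (D r) x \notin inner (X i)].
    move=> /enters[x xP]; rewrite /f; case: pickP => [y yP|]; first by exists y.
    by move/(_ x); rewrite xP.
  have f_inj : {in b :\: wall (X i) &, injective f}.
    move=> r s rb sb; have [x -> /andP[xr _]] := fP r rb.
    have [y -> /andP[ys _]] := fP s sb; case=> xy; rewrite xy in xr.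
    have bwR := subset_trans (subsetDl b (wall (X i))) bR.
    exact: arcs_inj (subsetP bwR r rb) (subsetP bwR s sb) xr ys.
  have : #|b :\: wall (X i)| <= #|T i|.
    rewrite -(card_in_imset f_inj) -[X in _ <= X](card_imset _ (@Some_inj _)).
    apply: subset_leq_card; apply/subsetP=> _ /imsetP[r rb ->].
    have [x -> xP] := fP r rb; apply: imset_f; rewrite inE; apply/exists_inP.
    by have /setDP[rb' rw] := rb; exists r; rewrite ?rw // (subsetP bR).
  rewrite -cb -(cardsID (wall (X i)) b); move: bw; clear; lia.
apply: (@leq_trans (\sum_(i < l) #|T i|)); first exact: leq_sum.
have TE i : #|T i| = #|[set e | inr e \in T i]| + #|[set a | inl a \in T i]|.
  rewrite [LHS]card_set_sum big_sumType /= addnC !card_set_sum.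
  by congr (_ + _); apply: eq_bigr => x _; rewrite inE.
under eq_bigr => i _ do rewrite TE.
rewrite big_split /=; apply: leq_add.
  under eq_bigr => i _ do rewrite card_set_sum.
  rewrite exchange_big /hyp_entering card_set_sum /=; apply: leq_sum => e _.
  (* A hyperedge is trimmed to one arc in one arborescence, and the head of that arc lies in at most
     one inner set. *)
  have [/existsP[i eT]|] := boolP [exists i, inr e \in T i]; last first.
    rewrite negb_exists => /forallP no_i.
    by rewrite big1 // => i _; rewrite (negPf (no_i i)).
  move: (eT); rewrite inE => /exists_inP[r rR /and4P[_ er tX sX]].
  rewrite (bigD1 i) //= eT big1 => [|j ji]; last first.
    apply/eqP; rewrite eqb0 inE; apply/negP=> /exists_inP[s sR /and4P[_ es tX' _]].
    rewrite -(arcs_inj r s _ rR sR er es) in tX'.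
    by rewrite (disjointFr (disX _ _ ji) tX') in tX.
  rewrite addn0 lt0b; apply/existsP; exists i.
  have [[_ arcsE _ /(_ e) ends] _] := trimD r rR.
  move: er; rewrite arcsE inE => /ends[se te _].
  apply/andP; split; apply/set0Pn; first by exists (tgt (D r) (inr e)); rewrite inE te.
  by exists (src (D r) (inr e)); rewrite !inE se.
apply: leq_sum => i _; apply: subset_leq_card; apply/subsetP=> a.
rewrite !inE => /exists_inP[r rR /and4P[rw ar tX sX]].
have [[_ arcsE dypE hypE] [_ _ _ in1]] := trimD r rR.
have [sa ta] : src (D r) (inl a) \in dtail a /\ tgt (D r) (inl a) = dhead a.
  by apply: dypE; rewrite arcsE inE in ar.
rewrite -ta tX /=; apply/set0Pn; exists (src (D r) (inl a)); rewrite inE sa andbT.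
(* A source in the outer set would be in the wall, hence a root. A root other than [r] cannot occur
   in [D r]: it would have in-degree 1, while all arcs have their heads in [V]. So the source would
   be [r], which is outside the wall. *)
apply: contra rw => sO.
have sw : src (D r) (inl a) \in wall (X i) by rewrite inE sX.
have sR : src (D r) (inl a) \in R by move: sw; rewrite wX inE => /andP[].
have [<- //|sr] := eqVneq (src (D r) (inl a)) r.
have /andP[sD _] := arcsP ar.
have : 0 < indegree (D r) (src (D r) (inl a)) by rewrite in1.
case/card_gt0P=> x; rewrite inE => /andP[xD /eqP tx].
move: sR; rewrite -tx => /negPn; rewrite notin_roots => /negP[].
move: xD; rewrite arcsE inE; case: x {tx} => [b /dypE[_ ->]|e /hypE[_ te _]].
  exact: dhead_V.
exact: subsetP (hset_V e) _ te.
Qed.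

End MatroidRooted.

(* The subtraction on the right-hand side never truncates: the walls are
   subsets of R and the rank is monotone. *)
Theorem theorem10 (W : finType) (V R : {set W}) (H : mixed_hypergraph W)
    (M : matroid R) (HM : matroid_rooted V H M) :
  (exists B : W -> sub_mixed_hypergraph H, matroid_based_packing V M B) <->
  (forall (l : nat) (X : 'I_l -> biset W),
     biset_subpartition V X ->
     (forall i, wall (X i) = in_nbh H (inner (X i)) :&: R) ->
     \sum_(i < l) (mrank M R - mrank M (wall (X i))) <=
     hyp_entering H (fun i => inner (X i)) +
       \sum_(i < l) biset_indegree H (X i)).
Proof.
split=> [[B]|cond]; first exact: packing_condition.
exact: packing_exists.
Qed.
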